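(* Let $\Delta$ be a centrally symmetric (cs) simplicial complex on the ground set $V$, and let $\Theta=\theta_1,\ldots,\theta_\ell$ be linear forms in $\mathbb{R}[X]$ such that $\theta_1,\ldots,\theta_{\ell-1}$ are elements of $\mathbb{R}[X]^-_1$, and $\theta_\ell$ is either also in $\mathbb{R}[X]^-_1$ or $\theta_\ell=\sum_{v\in V} x_v$. If for some integer $i>1$ all $i$-stresses on $\Delta$ with respect to $\Theta$ are symmetric, i.e., $\mathcal{S}(\Delta,\Theta)_i=\mathcal{S}(\Delta,\Theta)^+_i$, then $\mathcal{S}(\Delta,\Theta)_{j}=\mathcal{S}(\Delta,\Theta)^+_{j}$ for all $j\geq i$. Furthermore, under this assumption, if $\mathcal{S}(\Delta,\Theta)_{j}\neq (0)$ for some $j> i$, then $\Delta$ contains the boundary complex of the $j$-cross-polytope as a subcomplex.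
   Context: A simplicial complex $\Delta$ on a finite ground set $V$ is a collection of subsets of $V$ (called faces) closed under inclusion; $v\in V$ is a vertex of $\Delta$ if $\{v\}\in\Delta$, and not all elements of $V$ are required to be vertices. $\Delta$ is centrally symmetric (cs) if $V$ is endowed with a free involution $\alpha:V\to V$ that induces a free involution on the set of all non-empty faces of $\Delta$: for every non-empty face $\tau\in\Delta$, $\alpha(\tau)\in\Delta$, $\alpha(\tau)\neq\tau$, $\alpha(\alpha(\tau))=\tau$. Write $-\tau=\alpha(\tau)$ and $-v=\alpha(v)$. (One may take $V=\{\pm1,\ldots,\pm n\}$.) Let $X=\{x_v: v\in V\}$ be variables and $\mathbb{R}[X]$ the polynomial ring, with degree-$i$ homogeneous part $\mathbb{R}[X]_i$. The involution acts on $\mathbb{R}[X]$ by the algebra automorphism $\alpha(x_v)=x_{-v}$. For a vector space $W$ with an action of $\alpha$, $W^+=\{w\in W: \alpha(w)=w\}$ and $W^-=\{w\in W:\alpha(w)=-w\}$; in particular $\mathbb{R}[X]_1^{-}$ is the space of linear forms $\theta$ with $\alpha(\theta)=-\theta$. For a linear form $c=\sum_v c_v x_v$, put $\partial_{c}w=\sum_{v\in V}c_v\,\frac{\partial w}{\partial x_v}$. The support of a monomial $\mu$ is $\mathrm{supp}(\mu)=\{v\in V: x_v\mid \mu\}$. A homogeneous polynomial $w\in\mathbb{R}[X]$ of degree $i$ (including $0$) is an $i$-stress on $\Delta$ with respect to $\Theta=\theta_1,\dots,\theta_\ell$ if every term $\mu$ of $w$ satisfies $\mathrm{supp}(\mu)\in\Delta$,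 and $\partial_{\theta_k}w=0$ for all $k=1,\dots,\ell$. The vector space of all $i$-stresses is denoted $\mathcal{S}(\Delta,\Theta)_i$; $\alpha$ acts on it when each $\theta_k$ lies in $\mathbb{R}[X]_1^+\cup\mathbb{R}[X]_1^-$, and the elements of $\mathcal{S}(\Delta,\Theta)_i^+$ are called symmetric $i$-stresses. The boundary complex of the $j$-cross-polytope is, as an abstract simplicial complex, the $j$-fold suspension of $\{\emptyset\}$: up to isomorphism, it has vertex set $\{\pm1,\ldots,\pm j\}$ and its faces are the subsets containing no pair $\{k,-k\}$. Containing it as a subcomplex means containing a subcomplex isomorphic to it. *)

(* Defs.v *)
From mathcomp Require Import all_boot all_order all_algebra.
From mathcomp Require Import reals.
From mathcomp Require Import mpoly.

Set Implicit Arguments.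
Unset Strict Implicit.
Unset Printing Implicit Defensive.

Import GRing.Theory.
Local Open Scope ring_scope.

(* A complex on the ground set V is given by its set of faces. The singletons
   [set v] need not all be faces, and the complex without faces is allowed. *)
Definition simplicial_complex (V : finType) (Delta : {set {set V}}) : Prop :=
  forall F G : {set V}, F \in Delta -> G \subset F -> G \in Delta.

Definition free_involution (V : finType) (alpha : V -> V) : Prop :=
  involutive alpha /\ (forall v, alpha v != v).

(* That tau |-> alpha @: tau is involutive follows from the involutivity of
   alpha on V. *)
Definition cs_complex (V : finType) (alpha : V -> V)
    (Delta : {set {set V}}) : Prop :=
  [/\ simplicial_complex Delta,
      free_involution alpha &
      forall F : {set V}, F \in Delta -> F != set0 ->
        alpha @: F \in Delta /\ alpha @: F != F].

Definition vertices (V : finType) (Delta : {set {set V}}) : {set V} :=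
  [set v | [set v] \in Delta].

Definition isomorphic_complexes (V W : finType)
    (Gamma : {set {set V}}) (Delta : {set {set W}}) : Prop :=
  exists f : V -> W,
    {in vertices Gamma &, injective f} /\
    [set f @: F | F : {set V} in Gamma] = Delta.

Definition contains_complex (V W : finType)
    (Delta : {set {set V}}) (Gamma : {set {set W}}) : Prop :=
  exists Delta' : {set {set V}},
    [/\ simplicial_complex Delta', Delta' \subset Delta &
        isomorphic_complexes Gamma Delta'].

(* (k, true) and (k, false) stand for the antipodal vertices k and -k. *)
Definition cross_polytope_boundary (j : nat) : {set {set 'I_j * bool}} :=
  [set F : {set 'I_j * bool} |
     [forall k, ~~ (((k, true) \in F) && ((k, false) \in F))]].

Section Stresses.

(* The variables of {mpoly R[#|V|]} are numbered by 'I_#|V|: the variable x_v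
   is 'X_(enum_rank v). *)
Variables (R : realType) (V : finType).

Definition xvar (v : V) : {mpoly R[#|V|]} := 'X_(enum_rank v).

Definition act_poly (alpha : V -> V) (w : {mpoly R[#|V|]}) : {mpoly R[#|V|]} :=
  w \mPo [tuple xvar (alpha (enum_val i)) | i < #|V|].

Definition linear_form : {pred {mpoly R[#|V|]}} :=
  [pred c : {mpoly R[#|V|]} | c \is 1.-homog].

Definition anti_linear_form (alpha : V -> V) : {pred {mpoly R[#|V|]}} :=
  [pred c in linear_form | act_poly alpha c == - c].

Definition dirderiv (c w : {mpoly R[#|V|]}) : {mpoly R[#|V|]} :=
  \sum_(v : V) c@_(U_(enum_rank v)) *: w^`M(enum_rank v).

Definition supp (m : 'X_{1..#|V|}) : {set V} :=
  [set v | m (enum_rank v) != 0%N].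

(* 0 is d.-homog for every d. *)
Definition stress (Delta : {set {set V}}) (l : nat)
    (Theta : 'I_l -> {mpoly R[#|V|]}) (i : nat) : {pred {mpoly R[#|V|]}} :=
  [pred w : {mpoly R[#|V|]} |
    [&& w \is i.-homog,
        all (fun m => supp m \in Delta) (msupp w) &
        [forall k, dirderiv (Theta k) w == 0]]].

Definition sym_stress (alpha : V -> V) (Delta : {set {set V}}) (l : nat)
    (Theta : 'I_l -> {mpoly R[#|V|]}) (i : nat) : {pred {mpoly R[#|V|]}} :=
  [pred w in stress Delta Theta i | act_poly alpha w == w].

End Stresses.

(* Main.v *)
Require Import Defs.
From mathcomp Require Import all_boot all_order all_algebra perm.
From mathcomp Require Import reals.
From mathcomp Require Import mpoly.

(** Write D_v for the derivation along x_v. Partial derivatives of a stress are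
    stresses, so if all stresses of degree j >= 2 are symmetric, then D_v w is
    symmetric for every stress w of degree j + 1.

    Let w be antisymmetric of degree j + 1. Then D_(-v) w = - D_v w for all v;
    since no face contains an antipodal pair, D_v D_v w = - D_v D_(-v) w = 0.
    With z_v = x_v + x_(-v), the value of the derivation along theta_k at z_v is
    the same for all v (0 or 2), so (z_u - z_v) D_u D_v w is a degree-j stress.
    It is antisymmetric, hence zero. So D_u D_v w = 0 for all u and v, and
    w = 0.

    For w symmetric, D_(-v) w = D_v w, so replacing a factor x_v by x_(-v) in a
    monomial of w yields a monomial of w. The supports of all monomials
    obtained from a given one by such flips form the facets of a
    cross-polytope boundary. *)

Set Implicit Arguments.
Unset Strict Implicit.
Unset Printing Implicit Defensive.

Import GRing.Theory Num.Theory.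
Local Open Scope ring_scope.

(** * Monomials: factors, supports and the action of the involution *)

Section Multinomials.

Variables (V : finType) (alpha : V -> V).
Implicit Types (m : 'X_{1..#|V|}) (v : V).

Definition mnm_var v : 'X_{1..#|V|} := U_(enum_rank v)%MM.

(** Exponents are pulled back along [alpha]. For an involution this is the same as renaming each
    factor x_v to x_(-v). *)
Definition mnm_act m : 'X_{1..#|V|} :=
  [multinom m (enum_rank (alpha (enum_val i))) | i < #|V|].

Lemma mnm_varE u v : mnm_var u (enum_rank v) = (u == v).
Proof. by rewrite mnm1E (inj_eq enum_rank_inj). Qed.

Lemma mnm_actE m v : mnm_act m (enum_rank v) = m (enum_rank (alpha v)).
Proof. by rewrite mnmE enum_rankK. Qed.

Lemma mnm_eqP m1 m2 :
  (forall v, m1 (enum_rank v) = m2 (enum_rank v)) -> m1 = m2.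
Proof. by move=> h; apply/mnmP => i; rewrite -(enum_valK i). Qed.

Lemma in_supp m v : (v \in supp m) = (m (enum_rank v) != 0%N).
Proof. by rewrite inE. Qed.

Lemma supp_addn m v : supp (m + mnm_var v)%MM = v |: supp m.
Proof.
apply/setP => u; rewrite in_setU1 !in_supp mnmDE mnm_varE addn_eq0 negb_and.
by rewrite orbC eqb0 negbK eq_sym.
Qed.

Lemma mnm_has_var m : m != 0%MM -> exists m' v, m = (m' + mnm_var v)%MM.
Proof.
move=> nz; have [v nzv] : exists v, m (enum_rank v) != 0%N.
  apply/existsP; apply: contraR nz; rewrite negb_exists => /forallP z.
  apply/eqP/mnm_eqP => v; rewrite mnm0E; apply/eqP.
  by move: (z v); rewrite negbK.
exists (m - mnm_var v)%MM, v; rewrite submK //.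
apply/mnm_lepP => i; rewrite -(enum_valK i) mnm_varE.
by case: eqP => // <-; rewrite lt0n.
Qed.

(** Lists the factors of a monomial with multiplicity, so that they can later be flipped one
    position at a time. *)
Lemma mnm_sum_var d m : mdeg m = d ->
  exists g : 'I_d -> V, m = (\sum_(k < d) mnm_var (g k))%MM.
Proof.
elim: d m => [|d IH] m dm.
  exists (ffun0 (card_ord 0)); rewrite big_ord0.
  by apply/eqP; rewrite -mdeg_eq0 dm.
have [|m' [v em]] := @mnm_has_var m; first by rewrite -mdeg_eq0 dm.
have [|g eg] := IH m'.
  by apply/eqP; rewrite -eqSS -dm em mdegD mdeg1 addn1.
exists (fun k => if unlift ord0 k is Some k' then g k' else v).
rewrite big_ord_recl unlift_none em eg addmC; congr (_ + _)%MM.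
by apply: eq_bigr => k _; rewrite liftK.
Qed.

Lemma in_supp_sum (I : finType) (g : I -> V) v :
  (v \in supp (\sum_i mnm_var (g i))%MM) = [exists i, g i == v].
Proof.
rewrite in_supp mnm_sumE sum_nat_eq0 negb_forall; apply: eq_existsb => i /=.
by rewrite mnm_varE eqb0 negbK.
Qed.

Hypothesis alphaK : involutive alpha.

Lemma mnm_act_addn m v :
  mnm_act (m + mnm_var v)%MM = (mnm_act m + mnm_var (alpha v))%MM.
Proof.
apply: mnm_eqP => u; rewrite mnm_actE !mnmDE mnm_actE !mnm_varE.
by rewrite (can2_eq alphaK alphaK).
Qed.

Lemma mnm_actK : involutive mnm_act.
Proof. by move=> m; apply: mnm_eqP => v; rewrite !mnm_actE alphaK. Qed.

Lemma supp_act m : supp (mnm_act m) = alpha @: supp m.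
Proof.
apply/setP => v; rewrite in_supp mnm_actE -in_supp.
by rewrite -{2}(alphaK v) mem_imset //; apply: can_inj alphaK.
Qed.

Lemma alpha_ord_inj :
  injective (fun i : 'I_#|V| => enum_rank (alpha (enum_val i))).
Proof.
by move=> i i' /enum_rank_inj /(can_inj alphaK) /enum_val_inj.
Qed.

Lemma mdeg_act m : mdeg (mnm_act m) = mdeg m.
Proof.
by rewrite !mdegE (reindex_inj alpha_ord_inj); apply: eq_bigr => i _;
  rewrite mnmE enum_rankK alphaK enum_valK.
Qed.

End Multinomials.

(** * Partial derivatives, directional derivatives and the action on polynomials *)

Section Polynomials.

Variables (R : realType) (V : finType) (alpha : V -> V).
Implicit Types (w p q c : {mpoly R[#|V|]}) (m : 'X_{1..#|V|}) (u v : V).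

Local Notation D v w := (mderiv (enum_rank v) w).

Lemma mcoeffD_var w m v :
  (D v w)@_m = w@_(m + mnm_var v) *+ (m (enum_rank v)).+1.
Proof. exact: mcoeff_deriv. Qed.

Lemma msupp_D w m v : (m \in msupp (D v w)) = ((m + mnm_var v)%MM \in msupp w).
Proof. by rewrite !mcoeff_msupp mcoeffD_var mulrn_eq0. Qed.

Lemma dhomog_D d w v : w \is d.+1.-homog -> D v w \is d.-homog.
Proof.
move/dhomogP => h; apply/dhomogP => m; rewrite msupp_D => /h /=.
by rewrite mdegD mdeg1 addn1 => -[].
Qed.

(** A monomial of positive degree has some factor x_v, and in characteristic zero it survives in D_v
    w. *)
Lemma dhomog_D_eq0 d w :
  w \is d.+1.-homog -> (forall v, D v w = 0) -> w = 0.
Proof.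
move=> /dhomogP h z; apply/mpolyP => m; rewrite mcoeff0; apply/eqP.
rewrite mcoeff_eq0; apply/negP => mw; have dm := h _ mw.
have [|m' [v em]] := @mnm_has_var V m; first by rewrite -mdeg_eq0 dm.
by move: mw; rewrite em -msupp_D z msupp0.
Qed.

Lemma mcoeff_act_poly w m : involutive alpha ->
  (act_poly alpha w)@_m = w@_(mnm_act alpha m).
Proof.
move=> alphaK.
(* The substitution permutes the variables, so the known coefficients of [msym] apply. *)
have -> : act_poly alpha w = msym (perm (alpha_ord_inj alphaK)) w.
  rewrite /act_poly /comp_mpoly /msym /mmap.
  apply: eq_bigr => m' _; congr (_ * _).
  by apply: mmap1_eq => i; rewrite tnth_mktuple permE.
by rewrite mcoeff_sym; congr (_ @_ _); apply/mnmP => i; rewrite !mnmE permE.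
Qed.

Lemma act_polyB w p :
  act_poly alpha (w - p) = act_poly alpha w - act_poly alpha p.
Proof. exact: comp_mpolyB. Qed.

Lemma act_polyM w p :
  act_poly alpha (w * p) = act_poly alpha w * act_poly alpha p.
Proof. exact: rmorphM. Qed.

Lemma act_xvar v : act_poly alpha (xvar R v) = xvar R (alpha v).
Proof. by rewrite /act_poly comp_mpolyXU -tnth_nth tnth_mktuple enum_rankK. Qed.

Lemma dirderivB c w p : dirderiv c (w - p) = dirderiv c w - dirderiv c p.
Proof.
by rewrite -sumrB; apply: eq_bigr => v _; rewrite mderivB scalerBr.
Qed.

Lemma dirderivD c w p : dirderiv c (w + p) = dirderiv c w + dirderiv c p.
Proof.
by rewrite -big_split; apply: eq_bigr => v _; rewrite mderivD scalerDr.
Qed.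

Lemma dirderivM c w p :
  dirderiv c (w * p) = dirderiv c w * p + w * dirderiv c p.
Proof.
rewrite mulr_suml mulr_sumr -big_split; apply: eq_bigr => v _ /=.
by rewrite mderivM scalerDr scalerAl scalerAr.
Qed.

Lemma dirderivN c w : dirderiv (- c) w = - dirderiv c w.
Proof.
by rewrite -sumrN; apply: eq_bigr => v _; rewrite mcoeffN scaleNr.
Qed.

Lemma dirderiv_xvar c v : dirderiv c (xvar R v) = (c@_(mnm_var v))%:MP.
Proof.
rewrite /dirderiv (bigD1 v) //= big1 ?addr0 => [|u ne].
  rewrite mderivX mnm1E eqxx scale1r -[X in (X - _)%MM]add0m addmK mpolyX0.
  by rewrite -mul_mpolyC mulr1.
by rewrite mderivX mnm_varE eq_sym (negPf ne) scale0r scaler0.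
Qed.

Lemma dirderiv_D c w v : dirderiv c (D v w) = D v (dirderiv c w).
Proof.
rewrite /dirderiv raddf_sum; apply: eq_bigr => u _.
by rewrite /= mderivZ mderiv_comm.
Qed.

Hypothesis alphaK : involutive alpha.

Lemma mcoeff_act_var c v :
  (act_poly alpha c)@_(mnm_var v) = c@_(mnm_var (alpha v)).
Proof.
rewrite mcoeff_act_poly //; congr (_ @_ _).
apply: mnm_eqP => u; rewrite mnm_actE !mnm_varE.
by rewrite (can2_eq alphaK alphaK).
Qed.

Lemma act_polyK : involutive (act_poly alpha : {mpoly R[#|V|]} -> _).
Proof.
by move=> w; apply/mpolyP => m; rewrite !mcoeff_act_poly // mnm_actK.
Qed.

Lemma msupp_act w m :
  (m \in msupp (act_poly alpha w)) = (mnm_act alpha m \in msupp w).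
Proof. by rewrite !mcoeff_msupp mcoeff_act_poly. Qed.

Lemma D_act w v : D v (act_poly alpha w) = act_poly alpha (D (alpha v) w).
Proof.
apply/mpolyP => m; rewrite mcoeffD_var !mcoeff_act_poly // mcoeffD_var.
by rewrite mnm_act_addn // mnm_actE alphaK.
Qed.

(** Chain rule: moving the action past the derivative transforms the direction. *)
Lemma dirderiv_act c w :
  dirderiv c (act_poly alpha w) = act_poly alpha (dirderiv (act_poly alpha c) w).
Proof.
rewrite /dirderiv /act_poly raddf_sum /= (reindex_inj (can_inj alphaK)).
apply: eq_bigr => v _ /=; rewrite linearZ /= -/(act_poly _ _) D_act alphaK.
by rewrite -mcoeff_act_var.
Qed.

End Polynomials.

(** * Stresses on a centrally symmetric complex *)

Section Stresses.

Variables (R : realType) (V : finType) (alpha : V -> V) (Delta : {set {set V}}).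
Variables (l : nat) (Theta : 'I_l -> {mpoly R[#|V|]}).
Implicit Types (w p q c : {mpoly R[#|V|]}) (m : 'X_{1..#|V|}) (u v : V).

Hypothesis Hcs : cs_complex alpha Delta.
Hypothesis HTheta : forall k : 'I_l,
  act_poly alpha (Theta k) = - Theta k \/ Theta k = \sum_(v : V) xvar R v.

Local Notation D v w := (mderiv (enum_rank v) w).
Local Notation S := (stress Delta Theta).

Let alphaK : involutive alpha. Proof. by case: Hcs => _ []. Qed.
Let alpha_free v : alpha v != v. Proof. by case: Hcs => _ []. Qed.

(** Otherwise {v, -v} would be a nonempty face fixed by the involution. *)
Lemma antipodal_not_face (F : {set V}) v :
  F \in Delta -> v \in F -> alpha v \notin F.
Proof.
case: Hcs => sc _ fr FD vF; apply/negP => avF.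
have [] := fr [set v; alpha v].
- by apply: sc FD _; rewrite subUset !sub1set vF.
- by apply/set0Pn; exists v; rewrite !inE eqxx.
- by rewrite imsetU !imset_set1 alphaK setUC eqxx.
Qed.

Lemma stressP d w :
  reflect [/\ w \is d.-homog, {in msupp w, forall m, supp m \in Delta}
            & forall k, dirderiv (Theta k) w = 0] (w \in S d).
Proof.
rewrite inE; apply: (iffP and3P) => -[h1 h2 h3]; split => //.
- exact/allP.
- by move=> k; exact/eqP/(forallP h3 k).
- exact/allP.
- by apply/forallP => k; apply/eqP.
Qed.

(** Each form of [Theta] is an eigenvector of the action, with eigenvalue -1 or 1, so the chain rule
    changes its derivative by a sign at most. *)
Lemma dirderiv_act_Theta k w :
  dirderiv (Theta k) w = 0 -> dirderiv (Theta k) (act_poly alpha w) = 0.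
Proof.
move=> z; rewrite dirderiv_act //; have [->|e] := HTheta k.
  by rewrite dirderivN z oppr0 /act_poly raddf0.
suff -> : act_poly alpha (Theta k) = Theta k by rewrite z /act_poly raddf0.
rewrite e /act_poly raddf_sum /= [RHS](reindex_inj (can_inj alphaK)).
by apply: eq_bigr => v _; rewrite /= -act_xvar.
Qed.

Lemma stressB d w p : w \in S d -> p \in S d -> w - p \in S d.
Proof.
move=> /stressP [hw fw tw] /stressP [hp fp tp]; apply/stressP; split.
- exact: rpredB.
- by move=> m /msuppB_le; rewrite mem_cat => /orP [/fw|/fp].
- by move=> k; rewrite dirderivB tw tp subrr.
Qed.

Lemma stress_act d w : w \in S d -> act_poly alpha w \in S d.
Proof.
move=> /stressP [/dhomogP hw fw tw]; apply/stressP; split.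
- by apply/dhomogP => m; rewrite msupp_act // => /hw /=; rewrite mdeg_act.
- move=> m; rewrite msupp_act // => /fw; rewrite supp_act // => fm.
  (* The symmetry of the complex concerns nonempty faces only, so the constant monomial is treated
     apart. *)
  have [m0|nz] := eqVneq (supp m) set0; first by rewrite m0 imset0 in fm *.
  case: Hcs => _ _ /(_ _ fm) []; first by rewrite imset_eq0.
  by rewrite -imset_comp (eq_imset _ (_ : _ =1 id)) ?imset_id // => v /=.
- by move=> k; apply: dirderiv_act_Theta.
Qed.

Lemma stress_D d w v : w \in S d.+1 -> D v w \in S d.
Proof.
case: Hcs => sc _ _ /stressP [hw fw tw]; apply/stressP; split.
- exact: dhomog_D.
- move=> m; rewrite msupp_D => /fw /sc; apply.
  by rewrite supp_addn subsetUr.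
- by move=> k; rewrite dirderiv_D tw raddf0.
Qed.

(** The operator x_v D_v only rescales each monomial by its exponent at v, so no new monomial
    appears. *)
Lemma supp_xvarD w v : {in msupp w, forall m, supp m \in Delta} ->
  {in msupp (xvar R v * D v w), forall m, supp m \in Delta}.
Proof.
move=> fw m; rewrite mulrC (perm_mem (msuppMX _ _)) => /mapP [m' m'w ->].
by rewrite addmC; apply: fw; rewrite -msupp_D.
Qed.

Definition zvar v : {mpoly R[#|V|]} := xvar R v + xvar R (alpha v).

Lemma dirderiv_zvar k u v :
  dirderiv (Theta k) (zvar u) = dirderiv (Theta k) (zvar v).
Proof.
rewrite !dirderivD !dirderiv_xvar -!mpolyCD; congr (_%:MP).
have [e|->] := HTheta k.
  by rewrite -!mcoeff_act_var // e !mcoeffN !addrN.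
suff c1 x : (\sum_(y : V) xvar R y)@_(mnm_var x) = 1 by rewrite !c1.
rewrite raddf_sum /= (bigD1 x) //= mcoeffXU eqxx big1 ?addr0 // => y ne.
by rewrite mcoeffXU (inj_eq enum_rank_inj) (negPf ne).
Qed.

(** The hypothesis turns x_(-u) D_u w into - x_(-u) D_(-u) w, so both summands of the product are
    covered by [supp_xvarD]. *)
Lemma supp_zvar w u : {in msupp w, forall m, supp m \in Delta} ->
  D (alpha u) w = - D u w ->
  {in msupp (zvar u * D u w), forall m, supp m \in Delta}.
Proof.
move=> fw e m; rewrite mulrDl => /msuppD_le; rewrite mem_cat => /orP [].
  exact: supp_xvarD.
move=> h; apply: (supp_xvarD (v := alpha u) fw).
by rewrite e mulrN (perm_mem (msuppN _)).
Qed.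

(** * Vanishing of antisymmetric stresses *)

Section AntisymmetricStress.

Variables (d : nat) (w : {mpoly R[#|V|]}).
Hypothesis Hsym : {in S d.+2, forall p, act_poly alpha p = p}.
Hypotheses (Sw : w \in S d.+3) (w_anti : act_poly alpha w = - w).

(** D_v w has the degree in which stresses are symmetric, while the action sends it to D_(-v) (-
    w). *)
Lemma anti_stress_D_alpha v : D (alpha v) w = - D v w.
Proof.
rewrite -[D v w]Hsym ?stress_D // -[in RHS](alphaK v) -D_act // w_anti.
by rewrite mderivN opprK.
Qed.

Lemma anti_stress_D_sqr v : D v (D v w) = 0.
Proof.
apply/oppr_inj; rewrite oppr0 -mderivN -anti_stress_D_alpha.
apply/eqP; rewrite -msupp_eq0 -[_ == _]negbK; apply/negP.
case E : (msupp _) => [//|m s] _.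
(* Such an m comes from a monomial of w divisible by x_v x_(-v), whose support is no face. *)
have : m \in msupp (D v (D (alpha v) w)) by rewrite E inE eqxx.
rewrite !msupp_D; case/stressP: Sw => _ fw _ /fw.
rewrite !supp_addn => /antipodal_not_face /(_ (_ : v \in _)).
by rewrite !inE !eqxx ?orbT => /(_ isT).
Qed.

Lemma anti_stress_zvar u v : (zvar u - zvar v) * D u (D v w) \in S d.+2.
Proof.
have /stressP [hw fw tw] := Sw.
have Sv x := stress_D x Sw.
apply/stressP; split.
- rewrite -[d.+2]/(1 + d.+1)%N; apply: dhomogM; last exact/dhomog_D/dhomog_D.
  by apply: rpredB; apply: rpredD; rewrite dhomogX /= mdeg1.
(* The two products are handled separately: [supp_zvar] is used on D_v w for z_u and, after
   commuting the derivatives, on D_u w for z_v. *)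
- have zD x y : {in msupp (zvar x * D x (D y w)), forall m, supp m \in Delta}.
    have /stressP [_ fy _] := Sv y; apply: (supp_zvar fy).
    by rewrite mderiv_comm anti_stress_D_alpha mderivN mderiv_comm.
  move=> m; rewrite mulrBl => /msuppB_le; rewrite mem_cat => /orP [/zD //|].
  by rewrite mderiv_comm => /zD.
- move=> k; rewrite dirderivM dirderivB (dirderiv_zvar k u v) subrr mul0r.
  by rewrite !dirderiv_D tw !raddf0 mulr0 addr0.
Qed.

Lemma act_zvar v : act_poly alpha (zvar v) = zvar v.
Proof.
rewrite /zvar /act_poly comp_mpolyD -!/(act_poly _ _) !act_xvar.
by rewrite alphaK addrC.
Qed.

Lemma zvar_inj u v : zvar u = zvar v -> v = u \/ v = alpha u.
Proof.
move/(congr1 (mcoeff (mnm_var v))); rewrite !mcoeffD !mcoeffXU.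
rewrite !(inj_eq enum_rank_inj) eqxx (negPf (alpha_free v)).
have [->|_] := eqVneq u v; first by left.
have [->|_] := eqVneq (alpha u) v; first by right.
by move/eqP; rewrite !addr0 eq_sym oner_eq0.
Qed.

Lemma anti_stress_DD u v : D u (D v w) = 0.
Proof.
have Sq := Hsym (anti_stress_zvar u v).
have q0 : (zvar u - zvar v) * D u (D v w) = 0.
  move: Sq; rewrite act_polyM act_polyB !act_zvar.
  have -> : act_poly alpha (D u (D v w)) = - D u (D v w).
    rewrite -{1}[u]alphaK -D_act // Hsym ?stress_D //.
    by rewrite mderiv_comm anti_stress_D_alpha mderivN mderiv_comm.
  move/eqP; rewrite mulrN -subr_eq0 -opprD oppr_eq0 -mulr2n -scaler_nat.
  by rewrite scaler_eq0 pnatr_eq0 => /eqP.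
(* Polynomials form a domain. The factor z_u - z_v vanishes only for v = u or v = -u, where D_u D_v
   w is a second derivative D_u D_u w up to sign. *)
move/eqP: q0; rewrite mulf_eq0 subr_eq0 => /orP [/eqP /zvar_inj [] -> | /eqP //].
- exact: anti_stress_D_sqr.
- by rewrite anti_stress_D_alpha mderivN anti_stress_D_sqr oppr0.
Qed.

Lemma anti_stress_eq0 : w = 0.
Proof.
have /stressP [hw _ _] := Sw.
apply: (dhomog_D_eq0 hw) => v; apply: (dhomog_D_eq0 (dhomog_D v hw)) => u.
exact: anti_stress_DD.
Qed.

End AntisymmetricStress.

Lemma sym_stress_step d :
  {in S d.+2, forall p, act_poly alpha p = p} ->
  {in S d.+3, forall p, act_poly alpha p = p}.
Proof.
move=> Hsym p Sp; apply/eqP; rewrite -subr_eq0; apply/eqP.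
(* The antisymmetric stress used here is [act_poly alpha p - p]. *)
apply: (anti_stress_eq0 Hsym); first by rewrite stressB ?stress_act.
by rewrite act_polyB act_polyK // opprB.
Qed.

(** * Cross-polytopes from symmetric stresses *)

Section SymmetricStress.

Variables (d : nat) (w : {mpoly R[#|V|]}).
Hypothesis Hsym : {in S d, forall p, act_poly alpha p = p}.
Hypotheses (Sw : w \in S d.+1) (w_sym : act_poly alpha w = w).

Lemma sym_stress_flip m v :
  ((m + mnm_var (alpha v))%MM \in msupp w) = ((m + mnm_var v)%MM \in msupp w).
Proof.
rewrite -!msupp_D; congr (_ \in msupp _).
by rewrite -[in RHS]w_sym D_act // Hsym // stress_D.
Qed.

Let sgn (b : bool) v := if b then v else alpha v.

Lemma sym_stress_flips (g : 'I_d.+1 -> V) (e : 'I_d.+1 -> bool) :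
  (\sum_k mnm_var (g k))%MM \in msupp w ->
  (\sum_k mnm_var (sgn (e k) (g k)))%MM \in msupp w.
Proof.
move=> gw.
(* Induction on a list of positions to flip; a repeated position is flipped only once. *)
have flips (s : seq 'I_d.+1) :
    (\sum_k mnm_var (sgn (k \notin s) (g k)))%MM \in msupp w.
  elim: s => [//|x s IH].
  have [xs|xs] := boolP (x \in s).
    rewrite (eq_bigr (fun k => mnm_var (sgn (k \notin s) (g k)))) // => k _.
    by rewrite inE; case: eqP => // ->; rewrite xs.
  rewrite (bigD1 x) //= inE eqxx addmC sym_stress_flip addmC.
  have eqs k : k != x -> (k \notin x :: s) = (k \notin s).
    by rewrite inE => /negPf ->.
  under eq_bigr => k ne do rewrite eqs //.
  by move: IH; rewrite (bigD1 x) //= xs.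
have := flips [seq k <- enum 'I_d.+1 | ~~ e k].
rewrite (eq_bigr (fun k => mnm_var (sgn (e k) (g k)))) // => k _.
by rewrite mem_filter mem_enum andbT negbK.
Qed.

Lemma sym_stress_cross_polytope :
  w != 0 -> contains_complex Delta (cross_polytope_boundary d.+1).
Proof.
move=> nz; have /stressP [/dhomogP hw fw _] := Sw; have [sc _ _] := Hcs.
have [m mw] : exists m, m \in msupp w.
  move: nz; rewrite -msupp_eq0; case: (msupp w) => // m s.
  by exists m; rewrite inE eqxx.
have [g mE] := mnm_sum_var (hw _ mw); rewrite {}mE in mw.
pose f (x : 'I_d.+1 * bool) := sgn x.2 (g x.1).
have face e : supp (\sum_k mnm_var (f (k, e k)))%MM \in Delta.
  by apply/fw/sym_stress_flips.
have f_opp k b : f (k, ~~ b) = alpha (f (k, b)).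
  by rewrite /f /sgn; case: b; rewrite /= ?alphaK.
(* For equal indices, a coincidence would give a fixed point of [alpha]. For distinct ones, the
   signs [e] are chosen so that one face contains both f (k, b) and its antipode; in particular the
   monomial is squarefree. *)
have f_inj : injective f.
  move=> [k b] [k' b']; have [<-|ne] := eqVneq k k' => eqf.
    have [->//|neb] := eqVneq b b'; move/eqP: (eqf).
    have -> : b = ~~ b' by case: b b' neb {eqf} => [] [].
    by rewrite f_opp (negPf (alpha_free _)).
  pose e x := if x == k then b else ~~ b'.
  have := antipodal_not_face (face e) (_ : f (k, b) \in _).
  rewrite !in_supp_sum => /(_ _)/negP[].
    by apply/existsP; exists k; rewrite /e eqxx.
  by apply/existsP; exists k'; rewrite /e [k' == k]eq_sym (negPf ne) f_opp eqf.
exists [set f @: F | F : {set 'I_d.+1 * bool} in cross_polytope_boundary d.+1].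
split.
- move=> F G /imsetP [T]; rewrite inE => /forallP TP -> GT.
  (* Intersecting with T keeps the preimage free of antipodal pairs. *)
  apply/imsetP; exists (T :&: f @^-1: G).
    rewrite inE; apply/forallP => k; apply: contra (TP k).
    by rewrite !inE => /andP [/andP [-> _] /andP [-> _]].
  apply/setP => v; apply/idP/imsetP => [vG|[x]].
    have /imsetP [x xT vE] := subsetP GT _ vG.
    by exists x => //; rewrite !inE xT -vE.
  by rewrite !inE => /andP [_ ?] ->.
- apply/subsetP => _ /imsetP [T + ->]; rewrite inE => /forallP TP.
  apply: (sc _ _ (face (fun k => (k, true) \in T))).
  apply/subsetP => _ /imsetP [[k b] kT ->].
  rewrite in_supp_sum; apply/existsP; exists k; apply/eqP; congr (f (k, _)).
  case: b kT => // kF; apply/negP => kt; move: (TP k).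
  by rewrite kt kF.
- by exists f; split => // x y _ _; apply: f_inj.
Qed.

End SymmetricStress.

End Stresses.

Theorem theorem3p5 (R : realType) (V : finType) (alpha : V -> V)
    (Delta : {set {set V}}) (l : nat) (Theta : 'I_l -> {mpoly R[#|V|]})
    (Hcs : cs_complex alpha Delta)
    (Hanti : forall k : 'I_l, (k.+1 < l)%N ->
       Theta k \in anti_linear_form alpha)
    (Hlast : forall k : 'I_l, k.+1 = l ->
       Theta k \in anti_linear_form alpha \/
       Theta k = \sum_(v : V) xvar R v)
    (i : nat) (Hi : (1 < i)%N)
    (Hsym : stress Delta Theta i =i sym_stress alpha Delta Theta i) :
  (forall j : nat, (i <= j)%N ->
     stress Delta Theta j =i sym_stress alpha Delta Theta j) /\
  (forall j : nat, (i < j)%N ->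
     (exists2 w : {mpoly R[#|V|]}, w \in stress Delta Theta j & w != 0) ->
     contains_complex Delta (cross_polytope_boundary j)).
Proof.
have HTheta k : act_poly alpha (Theta k) = - Theta k \/
    Theta k = \sum_(v : V) xvar R v.
  have [kl|kl] := ltnP k.+1 l.
    by left; apply/eqP; have /andP [] := Hanti k kl.
  have /Hlast [/andP [_ /eqP]|] : k.+1 = l; [|by left|by right].
  by apply/eqP; rewrite eqn_leq kl ltn_ord.
have allsym j : (i <= j)%N ->
    {in stress Delta Theta j, forall p, act_poly alpha p = p}.
  elim: j => [|j IH]; first by rewrite leqNgt (ltnW Hi).
  rewrite leq_eqVlt => /predU1P [<- p|].
    by rewrite Hsym => /andP [_ /eqP].
  rewrite ltnS => ij; have := IH ij.
  (* Since i > 1, the induction step only occurs from degree at least 2, as [sym_stress_step]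
     requires. *)
  case: j ij {IH} => [|[|j]] ij; try by have := leq_trans Hi ij.
  exact: (sym_stress_step Hcs HTheta).
split=> [j ij w|j ij [w Sw nz]].
  rewrite [RHS]inE; apply/idP/andP => [Sw|[]//].
  by split=> //; rewrite (allsym j).
(* With the degree written as j + 1, the strict bound gives i <= j, so the first derivatives of w
   are symmetric as well as w. *)
case: j ij Sw => // j ij Sw.
apply: (sym_stress_cross_polytope Hcs (allsym j ij) Sw _ nz).
exact: (allsym _ (ltnW ij)).
Qed.
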